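(* Let $d\ge 2$ and $n,k\ge 0$ be integers. Then $N_d(n,k)$ equals the number of Dyck paths in $\mathcal{Q}_d$ with semilength $(d-1)(n-k)+k+1$ and exactly $k+1$ peaks.
   Context: $N_d(n,k) = \frac{1}{n+1} \binom{n+1}{k+1} \binom{ n + (n-k)(d-2)+1}{k}$. A Dyck path is a lattice path from $(0,0)$ with up steps $U=(1,1)$ and down steps $D=(1,-1)$, never going below the $x$-axis and ending on it at $(2m,0)$; $m$ is its semilength. An ascent is a maximal run of consecutive up steps; a peak is an occurrence of $UD$. $\mathcal{Q}_d$ is the set of nonempty Dyck paths in which every ascent has length congruent to $1$ modulo $d-1$. *)

(* Defs.v *)
From mathcomp Require Import all_boot all_order all_algebra.
From mathcomp Require Import classical_sets cardinality.

Set Implicit Arguments.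
Unset Strict Implicit.
Unset Printing Implicit Defensive.

Import Order.TTheory GRing.Theory Num.Theory.
Local Open Scope ring_scope.

(* a (a - 1) ... (a - k + 1) / k!: an integer upper argument is needed because
   n + (n - k)(d - 2) + 1 can be negative when k > n. *)
Definition binz (a : int) (k : nat) : rat :=
  (\prod_(i < k) (a - i%:Z)%:~R) / (k`!)%:R.

Lemma binz_nat (m k : nat) : binz m%:Z k = ('C(m, k))%:R.
Proof.
have kN0 : (k`!)%:R != 0 :> rat by rewrite pnatr_eq0 -lt0n fact_gt0.
apply: (mulIf kN0); rewrite /binz divfK // -natrM bin_ffact ffact_prod natr_prod.
have [lt_mk|le_km] := ltnP m k.
  rewrite (bigD1 (Ordinal lt_mk)) //= subrr mul0r.
  by rewrite (bigD1 (Ordinal lt_mk)) //= subnn mul0r.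
apply: eq_bigr => i _.
by rewrite subzn // ltnW // (leq_trans (ltn_ord i)).
Qed.

Definition Nd (d n k : nat) : rat :=
  (n.+1%:R)^-1 * ('C(n.+1, k.+1))%:R
  * binz (n%:Z + (n%:Z - k%:Z) * (d%:Z - 2) + 1) k.

Definition U : bool := true.
Definition D : bool := false.

Definition height (p : seq bool) : int :=
  \sum_(s <- p) (if s == U then 1 else -1).

Definition dyck (p : seq bool) : bool :=
  all (fun i => 0 <= height (take i p)) (iota 0 (size p).+1) && (height p == 0).

Definition semilength (p : seq bool) : nat := (size p)./2.

(* The default D of last and head makes a run at either end of p maximal. *)
Definition ascent (p : seq bool) (l : nat) : Prop :=
  (0 < l)%N /\ exists p1 p2 : seq bool,
    [/\ p = p1 ++ nseq l U ++ p2, last D p1 = D & head D p2 = D].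

Definition peaks (p : seq bool) : nat :=
  count (fun i => prefix [:: U; D] (drop i p)) (iota 0 (size p)).

Definition Qd (d : nat) (p : seq bool) : Prop :=
  [/\ p <> [::], dyck p & forall l, ascent p l -> (l = 1 %[mod d - 1])%N].

(* Main.v *)
Require Import Defs.
From mathcomp Require Import all_boot all_order all_algebra.
From mathcomp Require Import classical_sets cardinality.
From mathcomp Require Import zify.

Set Implicit Arguments.
Unset Strict Implicit.
Unset Printing Implicit Defensive.

Import Order.TTheory GRing.Theory Num.Theory.
Local Open Scope ring_scope.

(* A path in Q_d with k + 1 peaks is a list of ascents
   1 + (d - 1) b_i and descents.  Appending one down step makes the total height -1
   and every descent 1 + e_i, so that the b_i form a weak composition of n - k and
   the e_i one of (d - 1)(n - k) + 1, with k + 1 parts each.  Conversely such a pair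
   of compositions comes from a Dyck path iff the proper partial sums of the
   (d - 1) b_i - e_i, whose total is -1, are nonnegative; by the cycle lemma exactly
   one of the k + 1 rotations has this property.  Hence the count is
   C(n, k) C((d - 1)(n - k) + k + 1, k) / (k + 1). *)

(** * The cycle lemma *)

(* Only proper prefixes are tested: the total [h + \sum_(x <- w) x] is not. *)
Fixpoint nonneg_prefixes (h : int) (w : seq int) : bool :=
  if w is x :: w' then (0 <= h) && nonneg_prefixes (h + x) w' else true.

Lemma nonneg_prefixesP h w :
  reflect (forall j, (j < size w)%N -> 0 <= h + \sum_(x <- take j w) x)
          (nonneg_prefixes h w).
Proof.
elim: w h => [|x w IHw] h /=; first by left.
apply: (iffP andP) => [[h_ge0 /IHw w_ge0] [|j] lt_jw | w_ge0].
- by rewrite big_nil addr0.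
- by rewrite big_cons addrA w_ge0.
- split; first by have := w_ge0 0%N isT; rewrite big_nil addr0.
  apply/IHw => j lt_jw; have := w_ge0 j.+1 lt_jw.
  by rewrite big_cons addrA.
Qed.

(** For [i > 0], [drop i w] is a proper prefix of [rot i w] and [take i w] one of [w]; both sums
    would be nonnegative and could not add up to -1. *)
Lemma cycle_lemma_unique (w : seq int) (i : nat) :
  \sum_(x <- w) x = -1 -> (i < size w)%N ->
  nonneg_prefixes 0 w -> nonneg_prefixes 0 (rot i w) -> i = 0%N.
Proof.
move=> sum_w lt_iw /nonneg_prefixesP w_ge0 /nonneg_prefixesP rw_ge0.
case: i lt_iw rw_ge0 => // i lt_iw rw_ge0; exfalso.
have := w_ge0 _ lt_iw; have := rw_ge0 (size w - i.+1)%N.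
rewrite size_rot /rot take_cat size_drop ltnn subnn take0 cats0.
have -> : (size w - i.+1 < size w)%N by lia.
move/(_ isT); rewrite !add0r; move: sum_w.
rewrite -{1}(cat_take_drop i.+1 w) big_cat /=.
move: (\sum_(_ <- drop _ _) _) (\sum_(_ <- take _ _) _) => a b; lia.
Qed.

(* Rotate at the first minimum of the partial sums of positive length. *)
Lemma cycle_lemma_exists (w : seq int) :
  \sum_(x <- w) x = -1 ->
  exists2 i, (i < size w)%N & nonneg_prefixes 0 (rot i w).
Proof.
move=> sum_w; pose S j := \sum_(x <- take j w) x.
have [n size_w] : exists n, size w = n.+1.
  case: w sum_w @S => [|x w] sum_w _; first by rewrite big_nil in sum_w.
  by exists (size w).
have [i le_iw [lt_before le_after]] : exists2 i, (0 < i <= n.+1)%N &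
    (forall l, (0 < l < i)%N -> S i < S l) /\
    (forall l, (i <= l <= n.+1)%N -> S i <= S l).
  elim: n.+1 (ltn0Sn n) => // m IHm _.
  have [-> | m_gt0] := posnP m.
    by exists 1%N => //; split=> l Hl; [lia | have -> : l = 1%N by lia].
  have [i le_im [lt_before le_after]] := IHm m_gt0.
  have [le_iSm | lt_Smi] := leP (S i) (S m.+1).
    exists i; first by lia.
    split=> // l; case: (eqVneq l m.+1) => [-> //|ne_lm Hl]; apply: le_after; lia.
  exists m.+1; first by lia.
  split=> l Hl; last by have -> : l = m.+1 by lia.
  case: (ltnP l i) => [lt_li|le_il].
    by apply: lt_trans lt_Smi _; apply: lt_before; lia.
  by apply: lt_le_trans lt_Smi _; apply: le_after; lia.
have rot_i : nonneg_prefixes 0 (rot i w).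
  apply/nonneg_prefixesP => j; rewrite size_rot size_w add0r => lt_jn.
  have S_split : S i + \sum_(x <- drop i w) x = -1.
    by rewrite -sum_w -{2}(cat_take_drop i w) big_cat.
  (* A prefix inside [drop i w] has sum [S (i + j) - S i]; one that wraps around has sum
     [-1 - S i + S l] with [l < i]. *)
  rewrite /rot take_cat size_drop size_w; case: ltnP => cmp_j.
    have SD : S (i + j)%N = S i + \sum_(x <- take j (drop i w)) x.
      by rewrite /S takeD big_cat.
    by have := le_after (i + j)%N; move: SD; move: (\sum_(_ <- _) _) => a; lia.
  rewrite take_takel ?big_cat /=; last by lia.
  rewrite -/(S _); move: (\sum_(_ <- _) _) S_split => a S_split.
  set l := (j - _)%N.
  (* The length [l = 0] lies outside the range of the minimum; there [S i <= S n.+1 = -1]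
     suffices. *)
  have [-> | l_gt0] := posnP l; last by have := lt_before l; lia.
  have Sn : S n.+1 = -1 by rewrite /S -size_w take_size.
  have S0 : S 0%N = 0 by rewrite /S take0 big_nil.
  have := le_after n.+1; rewrite S0 Sn; lia.
(* If the minimum is at full length, the rotation is trivial and index 0 serves. *)
case: (ltnP i (size w)) => [lt_iw | ge_iw]; first by exists i.
exists 0%N; first by rewrite size_w.
by rewrite rot0; move: rot_i; rewrite rot_oversize.
Qed.

(** Rotation maps pairs of an index and a good tuple bijectively onto [A]: uniqueness gives
    injectivity, existence gives surjectivity. *)
Lemma card_cycle_lemma (T : finType) (n : nat) (c : T -> int)
    (A : {set n.-tuple T}) :
  (forall i t, t \in A -> rot_tuple i t \in A) ->
  (forall t, t \in A -> \sum_(x <- t) c x = -1) ->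
  (n * #|[set t in A | nonneg_prefixes 0 (map c t)]|)%N = #|A|.
Proof.
move=> A_rot A_sum; set G := [set t in A | _].
pose f (u : 'I_n * n.-tuple T) := rot_tuple u.1 u.2.
have sum_map t : t \in A -> \sum_(x <- map c t) x = -1.
  by move=> At; rewrite big_map A_sum.
have inj_f_le i j t u : t \in G -> u \in G -> (i <= j < n)%N ->
    rot i t = rot j u -> i = j /\ t = u.
  rewrite !inE => /andP[At Gt] /andP[Au Gu] le_ij eq_r.
  have eq_t : tval t = rot (j - i) u.
    apply: (@rot_inj i); rewrite eq_r -rotD ?size_tuple; last lia.
    by congr rot; lia.
  have ij0 : (j - i = 0)%N.
    apply: (cycle_lemma_unique (sum_map u Au)) => //.
      by rewrite size_map size_tuple; lia.
    by rewrite -map_rot -eq_t.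
  split; first by lia.
  by apply: val_inj; rewrite /= eq_t ij0 rot0.
have f_inj : {in finset.setX [set: 'I_n] G &, injective f}.
  move=> [i t] [j u] /finset.setXP[_ /= Gt] /finset.setXP[_ /= Gu] /(congr1 val) /= eq_r.
  have [le_ij | /ltnW le_ji] := leqP i j.
    have [|eq_ij ->] := @inj_f_le i j t u Gt Gu _ eq_r.
      by rewrite le_ij ltn_ord.
    by rewrite (val_inj eq_ij).
  have [|eq_ji ->] := @inj_f_le j i u t Gu Gt _ (esym eq_r).
    by rewrite le_ji ltn_ord.
  by rewrite (val_inj eq_ji).
have <- : f @: finset.setX [set: 'I_n] G = A.
  apply/setP => t; apply/imsetP/idP => [[[i u] /finset.setXP[_] /=] | At].
    by rewrite inE => /andP[Au _] ->; apply: A_rot.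
  have [i] := cycle_lemma_exists (sum_map t At).
  rewrite size_map size_tuple => lt_in good.
  (* Rotating the good tuple by a further [n - i] gives back [t]; the modulus covers [i = 0]. *)
  have lt_jn : ((n - i) %% n < n)%N by rewrite ltn_mod; lia.
  exists (Ordinal lt_jn, rot_tuple i t).
    by rewrite !inE A_rot //= map_rot.
  apply: val_inj; rewrite /= /f /=.
  have [-> | i_gt0] := posnP i; first by rewrite subn0 modnn !rot0.
  rewrite modn_small; last by lia.
  rewrite -rotD ?size_tuple subnK; try lia.
  by rewrite rot_oversize ?size_tuple.
by rewrite card_in_imset // cardsX cardsT card_ord.
Qed.

(** * Run-length encoding of paths *)

Definition path_of_runs (s : seq (nat * nat)) : seq bool :=
  flatten [seq nseq r.1 U ++ nseq r.2 D | r <- s].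

(** Positivity makes the encoding unique: a zero length would let neighbouring runs merge. *)
Definition positive_runs (s : seq (nat * nat)) : bool :=
  all (fun r => (0 < r.1)%N && (0 < r.2)%N) s.

(* [runs p] is the number of leading down steps of [p], followed by the list of
   (ascent, descent) pairs of the rest. *)
Fixpoint runs (p : seq bool) : nat * seq (nat * nat) :=
  match p with
  | [::] => (0%N, [::])
  | false :: p' => let: (f, s) := runs p' in (f.+1, s)
  | true :: p' =>
    match runs p' with
    | (0%N, (a, f) :: s) => (0%N, (a.+1, f) :: s)
    | (f, s) => (0%N, (1%N, f) :: s)
    end
  end.

Lemma runs_nseqD f p : runs (nseq f D ++ p) = ((runs p).1 + f, (runs p).2)%N.
Proof.
elim: f => [|f IHf] /=; first by rewrite addn0; case: runs.
by rewrite IHf addnS.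
Qed.

Lemma path_of_runsK s :
  positive_runs s -> runs (path_of_runs s) = (0%N, s).
Proof.
elim: s => [|[a f] s IHs] //= /andP[/andP[/= a_gt0 f_gt0] /IHs runs_s].
rewrite /path_of_runs /= -/(path_of_runs s) -catA.
case: a a_gt0 => // a _; elim: a => [|a IHa].
  by rewrite /= runs_nseqD runs_s add0n /=; case: f f_gt0.
by move: IHa; rewrite /= => ->.
Qed.

Lemma path_of_runs_inj s t : positive_runs s -> positive_runs t ->
  path_of_runs s = path_of_runs t -> s = t.
Proof.
move=> /path_of_runsK runs_s /path_of_runsK runs_t eq_st.
by move: runs_s; rewrite eq_st runs_t => -[].
Qed.

Lemma path_of_runs_cat s t :
  path_of_runs (s ++ t) = path_of_runs s ++ path_of_runs t.
Proof. by rewrite /path_of_runs map_cat flatten_cat. Qed.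

Lemma last_path_of_runs s : positive_runs s -> last D (path_of_runs s) = D.
Proof.
case/lastP: s => // s [a f]; rewrite /positive_runs all_rcons => /andP[/andP[_]].
rewrite -cats1 path_of_runs_cat /path_of_runs /= cats0 !last_cat.
by case: f => //= f _ _; elim: f.
Qed.

(** A final up step would leave a last pair with an empty descent, hence the condition on [last]. *)
Lemma runsK p : last D p = D ->
  positive_runs (runs p).2 /\
  nseq (runs p).1 D ++ path_of_runs (runs p).2 = p.
Proof.
elim: p => [|[] p IHp] //= last_p; last first.
  by have [pos eq_p] := IHp last_p; case: runs pos eq_p => f s /= pos ->.
have last_p' : last D p = D by case: p last_p {IHp}.
have [] := IHp last_p'; case: runs => [[|f] [|[a g] s]] /= pos eq_p.
- by rewrite -eq_p in last_p.
- by rewrite -eq_p; split=> //; case/andP: pos => /andP[_ ->].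
- by rewrite -eq_p.
- by rewrite -eq_p.
Qed.

Lemma peaks_cons x p : peaks (x :: p) = (prefix [:: U; D] (x :: p) + peaks p)%N.
Proof.
rewrite /peaks /=; congr addn; rewrite (iotaDl 1 0) count_map; exact: eq_count.
Qed.

Lemma peaks_path_of_runs s :
  positive_runs s -> peaks (path_of_runs s) = size s.
Proof.
elim: s => [|[a f] s IHs] //= /andP[/andP[/= a_gt0 f_gt0] /IHs <-].
rewrite /path_of_runs /= -/(path_of_runs s) -catA.
have down g q : peaks (nseq g D ++ q) = peaks q.
  by elim: g => //= g IHg; rewrite peaks_cons IHg.
case: a a_gt0 => // a _; case: f f_gt0 => // f _; elim: a => [|a IHa] /=.
  by rewrite !peaks_cons /= down prefix0s.
by rewrite peaks_cons IHa.
Qed.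

Lemma peaks_rconsD p : last D p = D -> peaks (rcons p D) = peaks p.
Proof.
elim: p => // x [|y p] IHp last_p; first by rewrite /= in last_p; rewrite last_p.
by rewrite rcons_cons peaks_cons IHp // [RHS]peaks_cons /= !prefix0s.
Qed.

(** At the end of [p], the default [D] of [head] already plays the part of the appended step. *)
Lemma ascent_rconsD p l : ascent (rcons p D) l <-> ascent p l.
Proof.
split=> -[l_gt0 [p1 [p2 [eq_p last_p1 head_p2]]]]; split=> //; last first.
  exists p1, (rcons p2 D); split=> //; last by case: p2 head_p2 {eq_p}.
  by rewrite eq_p -!rcons_cat.
case/lastP: p2 eq_p head_p2 => [|p2 x].
  case: l l_gt0 => // l _; rewrite cats0 -addn1 nseqD catA cats1.
  by move=> /rcons_inj[].
rewrite -!rcons_cat => /rcons_inj[eq_p _] head_p2.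
by exists p1, p2; split=> //; case: p2 head_p2 {eq_p}.
Qed.

(** Encoding the two sides of an ascent separately gives an encoding of the whole path with [l] in
    it; by uniqueness it is [s]. *)
Lemma ascent_path_of_runs s l : positive_runs s ->
  ascent (path_of_runs s) l <-> l \in map fst s.
Proof.
move=> pos_s; split=> [[l_gt0 [p1 [p2 [eq_p last_p1 head_p2]]]] | ].
  (* The default [U] makes this also say that [p2] is nonempty. *)
  have last_p2 : last U p2 = D.
    have := last_path_of_runs pos_s; rewrite eq_p !last_cat.
    by case: l l_gt0 {eq_p} => //= l _; elim: l.
  have [pos1 eq_p1] := runsK last_p1.
  have [|pos2 eq_p2] := @runsK p2; first by case: p2 last_p2 {eq_p head_p2}.
  case: (runs p1) pos1 eq_p1 => f1 s1 /= pos1 eq_p1.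
  case: (runs p2) pos2 eq_p2 => [[|f2] s2] /= pos2 eq_p2.
    case: s2 pos2 eq_p2 => [|[[|a] f] s2] //= _ eq_p2.
      by rewrite -eq_p2 in last_p2.
    by rewrite -eq_p2 in head_p2.
  have eq_s : path_of_runs s =
      nseq f1 D ++ path_of_runs (s1 ++ (l, f2.+1) :: s2).
    by rewrite eq_p -eq_p1 -eq_p2 path_of_runs_cat /path_of_runs /= -!catA.
  have := path_of_runsK pos_s; rewrite eq_s runs_nseqD path_of_runsK.
    by move=> [_ <-]; rewrite map_cat mem_cat inE eqxx orbT.
  by rewrite /positive_runs all_cat /= l_gt0; apply/andP.
case/mapP => -[a f] /splitPr sE -> /=; case: sE pos_s => s1 s2.
rewrite /positive_runs all_cat => /andP[pos1 /= /andP[/andP[/= a_gt0 f_gt0] _]].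
split=> //; exists (path_of_runs s1), (nseq f D ++ path_of_runs s2); split.
- by rewrite path_of_runs_cat /path_of_runs /= -!catA.
- exact: last_path_of_runs.
- by case: f f_gt0.
Qed.

(** * Heights along a path *)

Definition step (b : bool) : int := if b == U then 1 else -1.

Lemma heightE p : height p = \sum_(x <- map step p) x.
Proof. by rewrite /height big_map. Qed.

(** The proper prefixes of [rcons p D] are exactly all prefixes of [p]. *)
Lemma dyckE p :
  dyck p = nonneg_prefixes 0 (map step (rcons p D)) && (height p == 0).
Proof.
congr andb; apply/allP/nonneg_prefixesP => [pos j | pos j].
  rewrite size_map size_rcons add0r => lt_j.
  rewrite -map_take -heightE -cats1 takel_cat //.
  by apply: pos; rewrite mem_iota.
rewrite mem_iota add0n => /andP[_ lt_j]; have := pos j.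
rewrite size_map size_rcons add0r -map_take -heightE -cats1 takel_cat //.
exact.
Qed.

Lemma nonneg_prefixes_ascent h a w : (0 < a)%N ->
  nonneg_prefixes h (nseq a 1 ++ w) =
  (0 <= h) && nonneg_prefixes (h + a%:Z) w.
Proof.
case: a => // a _; elim: a h => [|a IHa] h //.
rewrite -[LHS]/((0 <= h) && nonneg_prefixes (h + 1) (nseq a.+1 1 ++ w)) IHa.
have -> : h + 1 + a.+1%:Z = h + a.+2%:Z by lia.
case: (leP 0 h) => //= h_ge0; have -> // : 0 <= h + 1 by lia.
Qed.

(** The lowest point tested within a descent is the one before its last step; its endpoint is left
    to [w]. *)
Lemma nonneg_prefixes_descent h f w : (0 < f)%N ->
  nonneg_prefixes h (nseq f (-1) ++ w) =
  (0 <= h - f%:Z + 1) && nonneg_prefixes (h - f%:Z) w.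
Proof.
case: f => // f _; elim: f h => [|f IHf] h.
  by rewrite /= subrK.
rewrite -[LHS]/((0 <= h) && nonneg_prefixes (h - 1) (nseq f.+1 (-1) ++ w)) IHf.
have -> : h - 1 - f.+1%:Z = h - f.+2%:Z by lia.
case: (leP 0 (h - f.+2%:Z + 1)) => h_ge0; last by rewrite andbF.
by have -> : 0 <= h by lia.
Qed.

Definition net (r : nat * nat) : int := r.1%:Z - r.2%:Z.

Lemma height_path_of_runs s :
  height (path_of_runs s) = \sum_(r <- s) net r.
Proof.
rewrite heightE; elim: s => [|[a f] s IHs]; first by rewrite !big_nil.
rewrite /path_of_runs /= !map_cat !big_cat /= IHs big_cons.
by rewrite !map_nseq !big_nseq !iter_addr !addr0 /step /= mulNrn !natz.
Qed.

(** The valleys of the path lie between consecutive pairs, so testing the start of each pair is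
    enough. *)
Lemma nonneg_prefixes_path_of_runs h s :
  positive_runs s -> h + \sum_(r <- s) net r = -1 ->
  nonneg_prefixes h (map step (path_of_runs s)) =
  nonneg_prefixes h (map net s).
Proof.
elim: s h => [|[a f] s IHs] h //= /andP[/andP[/= a_gt0 f_gt0] pos_s].
rewrite big_cons addrA => sum_s.
rewrite /path_of_runs /= -/(path_of_runs s) !map_cat !map_nseq -catA.
rewrite nonneg_prefixes_ascent // nonneg_prefixes_descent //; congr andb.
rewrite -[h + a%:Z - f%:Z]addrA -/(net (a, f)) IHs //.
(* The last descent ends at -1, so the point before is at 0; any other descent is followed by a pair
   whose start is tested. *)
case: s pos_s sum_s {IHs} => [_|r s _ _] /=.
  by rewrite big_nil addr0 => ->.
by case: leP => // lt_h; symmetry; apply/negbTE/negP => /andP[]; lia.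
Qed.

(** * Dyck paths and their run lengths *)

Lemma height_rcons p b : height (rcons p b) = height p + step b.
Proof. by rewrite /height big_rcons. Qed.

(** A final up step would start at height -1. *)
Lemma dyck_last p : dyck p -> last D p = D.
Proof.
case/lastP: p => // p [] /andP[/allP pos]; rewrite last_rcons // height_rcons.
have := pos (size p); rewrite mem_iota size_rcons -cats1 take_size_cat //.
by rewrite /step /=; lia.
Qed.

Lemma dyck_head p : dyck p -> head U p = U.
Proof. by rewrite dyckE => /andP[]; case: p => [|[] [|x p]]. Qed.

(* The final down step appended to [p] makes the total height [-1], as the cycle
   lemma wants, without creating a peak or changing an ascent. *)
Lemma QdP d p : Qd d p <-> exists s, [/\ positive_runs s,
  rcons p D = path_of_runs s, \sum_(r <- s) net r = -1,
  nonneg_prefixes 0 (map net s) &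
  forall r, r \in s -> r.1 = 1 %[mod d - 1]%N].
Proof.
split=> [[p_neq0 dyck_p asc_p] | [s [pos_s eq_p sum_s good_s asc_s]]].
  have [|pos_s] := @runsK (rcons p D); first by rewrite last_rcons.
  (* A nonempty Dyck path starts with an up step, so there are no leading down steps. *)
  case: runs pos_s => [[|f] s] /= pos_s eq_p; last first.
    by have := dyck_head dyck_p; case: p p_neq0 eq_p {dyck_p asc_p} => // x p _ [<-].
  have sum_s : \sum_(r <- s) net r = -1.
    rewrite -height_path_of_runs eq_p height_rcons.
    by case/andP: dyck_p => _ /eqP ->.
  exists s; split=> // [|r s_r].
    rewrite -nonneg_prefixes_path_of_runs ?add0r // eq_p.
    by move: dyck_p; rewrite dyckE => /andP[].
  apply: asc_p; apply/ascent_rconsD; rewrite -eq_p; apply/ascent_path_of_runs => //.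
  exact: map_f.
split.
- move=> p0; case: s pos_s eq_p {sum_s good_s asc_s} => [|[[|a] f] s] //=;
    by rewrite p0.
- rewrite dyckE eq_p nonneg_prefixes_path_of_runs ?add0r // good_s /=.
  by move: sum_s; rewrite -height_path_of_runs -eq_p height_rcons /step /=; lia.
- move=> l /ascent_rconsD; rewrite eq_p ascent_path_of_runs // => /mapP[r s_r ->].
  exact: asc_s.
Qed.

Lemma peaks_dyck p s : dyck p -> positive_runs s ->
  rcons p D = path_of_runs s -> peaks p = size s.
Proof.
move=> /dyck_last last_p pos_s eq_p.
by rewrite -peaks_rconsD // eq_p peaks_path_of_runs.
Qed.

Lemma size_path_of_runs s :
  size (path_of_runs s) = (\sum_(r <- s) r.1 + \sum_(r <- s) r.2)%N.
Proof.
elim: s => [|r s IHs]; first by rewrite !big_nil.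
by rewrite /path_of_runs /= !size_cat !size_nseq IHs !big_cons; lia.
Qed.

Lemma sum_net s : \sum_(r <- s) net r =
  (\sum_(r <- s) r.1)%N%:Z - (\sum_(r <- s) r.2)%N%:Z.
Proof.
elim: s => [|r s IHs]; first by rewrite !big_nil.
by rewrite !big_cons IHs /net; lia.
Qed.

(** With the appended step, the down steps outnumber the up steps by one; without it, [p] has twice
    as many steps as up steps. *)
Lemma semilength_runs p s :
  rcons p D = path_of_runs s -> \sum_(r <- s) net r = -1 ->
  semilength p = (\sum_(r <- s) r.1)%N.
Proof.
move/(congr1 size); rewrite size_rcons size_path_of_runs sum_net /semilength.
by lia.
Qed.

(** Each peak ends an ascent with at least one up step. This rules out all paths when [k > n]. *)
Lemma peaks_le_semilength d p : Qd d p -> (peaks p <= semilength p)%N.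
Proof.
move=> Qp; have [_ dyck_p _] := Qp.
have [s [pos_s eq_p sum_s _ _]] := (QdP d p).1 Qp.
rewrite (peaks_dyck dyck_p pos_s eq_p) (semilength_runs eq_p sum_s).
elim: s pos_s {eq_p sum_s} => //= r s IHs /andP[/andP[r_gt0 _] /IHs le_s].
by rewrite big_cons; lia.
Qed.

(** * Counting *)

(* A pair [(b, e)] stands for an ascent of length [1 + q b] followed by a descent
   of length [1 + e]. *)
Definition runs_of_excess (q : nat) (u : seq (nat * nat)) : seq (nat * nat) :=
  [seq ((q * x.1).+1, x.2.+1) | x <- u].

Definition excess_net (q : nat) (x : nat * nat) : int := (q * x.1)%N%:Z - x.2%:Z.

Lemma positive_runs_of_excess q u : positive_runs (runs_of_excess q u).
Proof. by apply/allP => r /mapP[x _ ->]. Qed.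

Lemma net_runs_of_excess q u :
  map net (runs_of_excess q u) = map (excess_net q) u.
Proof.
by rewrite -map_comp; apply: eq_map => x /=; rewrite /net /excess_net /=; lia.
Qed.

Lemma runs_of_excess_inj q : (0 < q)%N -> injective (runs_of_excess q).
Proof.
move=> q_gt0; apply: inj_map => -[b e] [b' e'] [/eqP].
by rewrite eqn_pmul2l // => /eqP -> ->.
Qed.

Lemma sum1_runs_of_excess q u :
  (\sum_(x <- runs_of_excess q u) x.1 = size u + q * \sum_(x <- u) x.1)%N.
Proof.
rewrite big_map; elim: u => [|x u IHu]; first by rewrite !big_nil muln0.
by rewrite !big_cons IHu /=; lia.
Qed.

Lemma sum2_runs_of_excess q u :
  (\sum_(x <- runs_of_excess q u) x.2 = size u + \sum_(x <- u) x.2)%N.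
Proof.
rewrite big_map; elim: u => [|x u IHu]; first by rewrite !big_nil.
by rewrite !big_cons IHu /=; lia.
Qed.

Lemma sum_excess_net q u : \sum_(x <- u) excess_net q x =
  (q * \sum_(x <- u) x.1)%N%:Z - (\sum_(x <- u) x.2)%N%:Z.
Proof.
elim: u => [|x u IHu]; first by rewrite !big_nil muln0.
by rewrite !big_cons IHu /excess_net; lia.
Qed.

(** Here [q] is [d - 1] and [r] is [n - k]. The descents of [rcons p D] total [q * r + k.+1 + 1];
    taking 1 from each of the [k.+1] leaves [(q * r).+1]. *)
Lemma Qd_excessP q r k p : (0 < q)%N ->
  [/\ Qd q.+1 p, semilength p = (q * r + k.+1)%N & peaks p = k.+1] <->
  exists u, [/\ rcons p D = path_of_runs (runs_of_excess q u), size u = k.+1,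
    (\sum_(x <- u) x.1 = r)%N, (\sum_(x <- u) x.2 = (q * r).+1)%N &
    nonneg_prefixes 0 (map (excess_net q) u)].
Proof.
move=> q_gt0; split=> [[Qp semi_p peaks_p] | [u [eq_p size_u sum1 sum2 good_u]]].
  have [_ dyck_p _] := Qp.
  have [s [pos_s eq_p sum_s good_s asc_s]] := (QdP _ p).1 Qp.
  (* The division is exact because every ascent length is 1 modulo [q]. *)
  pose u := [seq (r.1.-1 %/ q, r.2.-1)%N | r <- s].
  have s_u : s = runs_of_excess q u.
    rewrite /u /runs_of_excess -map_comp -{1}(map_id s); apply/eq_in_map.
    move=> [a f] s_af /=; have /andP[/= a_gt0 f_gt0] := allP pos_s _ s_af.
    have := asc_s _ s_af; rewrite /= subn1 /= => /eqP.
    rewrite -{1}(prednK a_gt0) -addn1 -{2}(add0n 1%N) eqn_modDr mod0n => q_dvd.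
    by rewrite mulnC divnK // !prednK.
  have size_u : size u = k.+1.
    by rewrite size_map -(peaks_dyck dyck_p pos_s eq_p).
  have := semilength_runs eq_p sum_s; rewrite semi_p => sum1_s.
  move: sum_s; rewrite sum_net -sum1_s {1}s_u sum2_runs_of_excess => sum2_s.
  move: sum1_s; rewrite s_u sum1_runs_of_excess size_u addnC => /addnI /eqP.
  rewrite eqn_pmul2l // => /eqP sum1_u.
  exists u; split=> //; first by rewrite -s_u.
    by rewrite size_u in sum2_s; lia.
  by rewrite -net_runs_of_excess -s_u.
have pos_s := positive_runs_of_excess q u.
have sum_s : \sum_(x <- runs_of_excess q u) net x = -1.
  by rewrite sum_net sum1_runs_of_excess sum2_runs_of_excess sum1 sum2; lia.
have Qp : Qd q.+1 p.
  apply/QdP; exists (runs_of_excess q u); split=> //.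
    by rewrite net_runs_of_excess.
  move=> _ /mapP[x _ ->] /=.
  by rewrite subn1 /= -addn1 mulnC modnMDl.
have [_ dyck_p _] := Qp; split=> //.
  by rewrite (semilength_runs eq_p sum_s) sum1_runs_of_excess sum1 size_u addnC.
by rewrite (peaks_dyck dyck_p pos_s eq_p) size_map.
Qed.

(** Pairs of weak compositions of [r] and [s]; a part never exceeds its total, so bounded entries
    lose nothing and give a finite type. *)
Definition pair_partitions (k r s : nat) :
    {set k.+1.-tuple ('I_r.+1 * 'I_s.+1)} :=
  [set t : k.+1.-tuple ('I_r.+1 * 'I_s.+1) |
    (\sum_(x <- t) x.1 == r)%N && (\sum_(x <- t) x.2 == s)%N].

(** Unzipping separates the two compositions, each counted by [card_ord_partitions]. *)
Lemma card_pair_partitions k r s :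
  #|pair_partitions k r s| = ('C(k + r, k) * 'C(k + s, k))%N.
Proof.
rewrite -!card_ord_partitions -cardsX.
pose f (t : k.+1.-tuple ('I_r.+1 * 'I_s.+1)) := (map_tuple fst t, map_tuple snd t).
have f_inj : injective f.
  move=> t u [eq1 eq2]; apply: val_inj; rewrite -[val t]zip_unzip -[val u]zip_unzip.
  by rewrite /unzip1 /unzip2 eq1 eq2.
rewrite -(card_imset _ f_inj); congr (#|pred_of_set _|).
apply/setP => -[b e]; rewrite !inE; apply/imsetP/idP => [[t] | /andP[/= sum_b sum_e]].
  by rewrite inE => /andP[sum1 sum2] [-> ->]; rewrite /= !big_map sum1.
have bE : unzip1 (zip b e) = b by rewrite unzip1_zip ?size_tuple.
have eE : unzip2 (zip b e) = e by rewrite unzip2_zip ?size_tuple.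
exists (zip_tuple b e); last by congr pair; apply: val_inj.
rewrite inE; apply/andP; split.
  by move: sum_b; rewrite -{1}bE big_map.
by move: sum_e; rewrite -{1}eE big_map.
Qed.

Lemma leq_sum_mem (T : eqType) (F : T -> nat) (s : seq T) x :
  x \in s -> (F x <= \sum_(y <- s) F y)%N.
Proof. by move=> s_x; rewrite (perm_big _ (perm_to_rem s_x)) big_cons leq_addr. Qed.

Definition excess_of (k r s : nat) (t : k.+1.-tuple ('I_r.+1 * 'I_s.+1)) :
    seq (nat * nat) :=
  [seq (val x.1, val x.2) | x <- t].

Lemma excess_of_inj k r s : injective (@excess_of k r s).
Proof.
move=> t u /inj_map eq_tu; apply: val_inj; apply: eq_tu => -[b e] [b' e'] [].
by move=> /val_inj -> /val_inj ->.
Qed.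

Lemma excess_ofP k r s u :
  [/\ size u = k.+1, (\sum_(x <- u) x.1 = r)%N & (\sum_(x <- u) x.2 = s)%N] <->
  exists2 t, t \in pair_partitions k r s & u = excess_of t.
Proof.
split=> [[size_u sum1 sum2] | [t]]; last first.
  rewrite inE => /andP[/eqP sum1 /eqP sum2] ->.
  by rewrite size_map size_tuple !big_map.
have size_t : size [seq (inord x.1 : 'I_r.+1, inord x.2 : 'I_s.+1) | x <- u] == k.+1.
  by rewrite size_map size_u.
have u_t : u = excess_of (Tuple size_t).
  rewrite /excess_of /= -map_comp -{1}(map_id u); apply/eq_in_map => -[b e] u_x.
  rewrite /= !inordK //= ltnS -?sum1 -?sum2.
    exact: (leq_sum_mem snd u_x).
  exact: (leq_sum_mem fst u_x).
exists (Tuple size_t) => //; rewrite inE.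
move: (Tuple size_t) u_t => t u_t.
by move: sum1 sum2; rewrite u_t !big_map => -> ->; rewrite !eqxx.
Qed.

Definition good_partitions (q k r : nat) :
    {set k.+1.-tuple ('I_r.+1 * 'I_(q * r).+2)} :=
  [set t in pair_partitions k r (q * r).+1 |
    nonneg_prefixes 0 (map (excess_net q) (excess_of t))].

(** Rotation preserves both sums, and the weights [excess_net] total [q * r - (q * r).+1 = -1], so
    the cycle lemma applies. *)
Lemma card_good_partitions q k r :
  (k.+1 * #|good_partitions q k r| = 'C(k + r, k) * 'C(q * r + k.+1, k))%N.
Proof.
have -> : (q * r + k.+1 = k + (q * r).+1)%N by lia.
rewrite -card_pair_partitions.
rewrite -(@card_cycle_lemma _ _ (fun x => excess_net q (val x.1, val x.2))
  (pair_partitions _ _ _)).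
- congr muln; apply: eq_card => t.
  by rewrite !inE /excess_of -map_comp.
- move=> i t; rewrite !inE /=.
  by have /permEl rot_t := perm_rot i t; rewrite !(perm_big _ rot_t).
- move=> t; rewrite inE => /andP[/eqP sum1 /eqP sum2].
  have := sum_excess_net q (excess_of t); rewrite !big_map sum1 sum2 => ->; lia.
Qed.

(** For [k <= n] the upper argument is a natural number; the rest is
    [n.+1 * 'C(n, k) = k.+1 * 'C(n.+1, k.+1)]. *)
Lemma NdE d n k : (2 <= d)%N -> (k <= n)%N ->
  Nd d n k * k.+1%:R =
  ('C(n, k) * 'C((d - 1) * (n - k) + k.+1, k))%N%:R.
Proof.
move=> d_ge2 le_kn; rewrite /Nd.
have -> : n%:Z + (n%:Z - k%:Z) * (d%:Z - 2) + 1 =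
          ((d - 1) * (n - k) + k.+1)%N%:Z by nia.
have n1_neq0 : n.+1%:R != 0 :> rat by rewrite pnatr_eq0.
rewrite binz_nat mulrAC natrM; congr (_ * _).
apply: (mulfI n1_neq0); rewrite -mulrA mulVKf // -!natrM.
by rewrite mulnC mul_bin_diag.
Qed.

(** * Enumeration of the set of paths *)

Local Open Scope classical_set_scope.
Local Open Scope card_scope.
Local Open Scope ring_scope.

Lemma card_eq_uniq_seq (T : choiceType) (s : seq T) :
  uniq s -> [set` s] #= `I_(size s).
Proof.
case: s => [|x0 s0]; first by rewrite set_nil II0.
set s := x0 :: s0 => uniq_s.
have -> : [set` s] = nth x0 s @` `I_(size s).
  apply/seteqP; split=> [x /= s_x | _ [i /= lt_is <-]]; last exact: mem_nth.
  have lt_xs : (index x s < size s)%N by rewrite index_mem.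
  by exists (index x s) => //; exact: nth_index.
apply: inj_card_eq => i j /set_mem lt_i /set_mem lt_j /eqP.
by rewrite nth_uniq // => /eqP.
Qed.

Theorem theorem3p3 (d n k : nat) (hd : (2 <= d)%N) :
  exists c : nat,
    [set p : seq bool |
      [/\ Qd d p,
          (semilength p)%:Z = (d%:Z - 1) * (n%:Z - k%:Z) + k%:Z + 1
        & peaks p = k.+1]] #= `I_c
    /\ Nd d n k = c%:R.
Proof.
case: (leqP k n) => [le_kn | lt_nk]; last first.
  (* For [k > n] the factor ['C(n.+1, k.+1)] vanishes, and the prescribed semilength is below the
     [k.+1] peaks. *)
  exists 0%N; split; last by rewrite /Nd bin_small // mulr0 mul0r.
  rewrite II0 card_eq0; apply/eqP/seteqP; split=> // p [Qp semi_p peaks_p].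
  by have := peaks_le_semilength Qp; rewrite peaks_p /=; nia.
set q := (d - 1)%N; set r := (n - k)%N.
have d_q : d = q.+1 by rewrite /q; lia.
have q_gt0 : (0 < q)%N by rewrite /q; lia.
pose path_of t := path_of_runs (runs_of_excess q (@excess_of k r (q * r).+1 t)).
(* This removes the appended down step; [path_of t] is nonempty as it has [k.+1] ascents. *)
pose dyck_of t := take (size (path_of t)).-1 (path_of t).
have path_ofK t : rcons (dyck_of t) D = path_of t.
  rewrite /dyck_of; have : last D (path_of t) = D.
    exact/last_path_of_runs/positive_runs_of_excess.
  have : path_of t <> [::] by rewrite /path_of; case/tupleP: t.
  case/lastP: (path_of t) => // p x _; rewrite last_rcons => ->.
  by rewrite size_rcons -(cats1 p) take_size_cat // cats1.
have dyck_of_inj : injective dyck_of.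
  move=> t u eq_tu; apply: excess_of_inj; apply: (runs_of_excess_inj q_gt0).
  apply: path_of_runs_inj; try exact: positive_runs_of_excess.
  by rewrite -/(path_of t) -/(path_of u) -!path_ofK eq_tu.
pose S := map dyck_of (enum (good_partitions q k r)).
exists #|good_partitions q k r|; split.
  have -> : #|good_partitions q k r| = size S by rewrite size_map -cardE.
  set P := (X in X #= _); suff <- : [set` S] = P.
    by apply: card_eq_uniq_seq; rewrite map_inj_uniq ?enum_uniq.
  have semiE p : (semilength p)%:Z = (d%:Z - 1) * (n%:Z - k%:Z) + k%:Z + 1 <->
      semilength p = (q * r + k.+1)%N.
    by rewrite /q /r; split; nia.
  apply/seteqP; split=> [p /= /mapP[t] | p /= [Qp /semiE semi_p peaks_p]].
    rewrite mem_enum inE => /andP[t_part good_t] ->.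
    have [size_t sum1 sum2] := (excess_ofP _ _ _ _).2 (ex_intro2 _ _ t t_part erefl).
    have [|Qp semi_p peaks_p] := (Qd_excessP r k (dyck_of t) q_gt0).2.
      by exists (excess_of t); split.
    by rewrite -d_q in Qp; split=> //; apply/semiE.
  have [|u [eq_p size_u sum1 sum2 good_u]] := (Qd_excessP r k p q_gt0).1.
    by rewrite -d_q.
  have [|t t_part u_t] := (excess_ofP k r (q * r).+1 u).1; first by split.
  apply/mapP; exists t; first by rewrite mem_enum inE t_part -u_t.
  have : rcons p D = rcons (dyck_of t) D by rewrite path_ofK eq_p u_t.
  by move/rcons_inj => [].
have k1_neq0 : k.+1%:R != 0 :> rat by rewrite pnatr_eq0.
(* Both sides times [k.+1] are the same product of binomials, since [k + r = n]. *)
apply: (mulIf k1_neq0); rewrite NdE // -natrM -/q -/r mulnC; congr _%:R.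
by rewrite mulnC [RHS]mulnC card_good_partitions subnKC.
Qed.
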